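(* Let $\mathbb F\in\{\mathbb R,\mathbb C,\mathbb H\}$, $m\ge1$, $s_m=\frac{2(m+1)}m$, and let $E\subset T_{[x]}\mathbb FP^m$ be a real $k$-dimensional subspace with $g_0$-orthonormal basis $\{u_1,\dots,u_k\}$. Let $\bar u_i=\frac1{\sqrt{s_m}}u_i$, so that $\{\bar u_1,\dots,\bar u_k\}$ is the corresponding orthonormal basis of $E$ with respect to $g_\Phi=s_mg_0$. Then the second fundamental form $B$ of the standard embedding $\Phi_{\mathbb F}:(\mathbb FP^m,s_mg_0)\to\mathbb S^N$ satisfies $$\left|\sum_{i=1}^kB(\bar u_i,\bar u_i)\right|^2=\frac{k(m-k)+m\,\Theta_{\mathbb F}(E)}{m+1}.$$ In particular, when $\mathbb F=\mathbb R$, $\left|\sum_{i=1}^kB(\bar u_i,\bar u_i)\right|^2=\dfrac{k(m-k)}{m+1}$.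
   Context: For $\mathbb F\in\{\mathbb R,\mathbb C,\mathbb H\}$ let $d=\dim_{\mathbb R}\mathbb F$, $n=m+1$. $\mathbb F^{n}$ is a right $\mathbb F$-vector space with $\langle x,y\rangle_{\mathbb F}=x^*y$ and real inner product $\langle x,y\rangle_{\mathbb R}=\operatorname{Re}(x^*y)$. $\mathbb FP^m=\mathbb S^{dn-1}/\mathbb S^{d-1}$ is the quotient of the unit sphere by unit scalars acting on the right; $g_0$ is the quotient (Riemannian submersion) metric, so that $T_{[x]}\mathbb FP^m\simeq x^\perp=\{u\in\mathbb F^n:x^*u=0\}$ isometrically for $\langle\cdot,\cdot\rangle_{\mathbb R}$. $J$ denotes the complex structure of $\mathbb CP^m$ and $(J_1,J_2,J_3)$ a local admissible frame of the quaternionic structure of $\mathbb HP^m$ (locally induced on $x^\perp$ by right multiplication by the three imaginary units). Standard embedding. $\mathcal H_n^0(\mathbb F)$ is the real vector space of trace-free Hermitian $n\times n$ matrices over $\mathbb F$ with inner product $\langle A,B\rangle=\operatorname{Re}\operatorname{tr}(AB)$, and $\mathbb S^N$ is its unit sphere. For unit $x$, $\Phi_{\mathbb F}([x])=\sqrt{\frac{m+1}{m}}\,(xx^*-\frac1nI_n)$; it is an isometric embedding $(\mathbb FP^m,s_mg_0)\to\mathbb S^N$, and $B$ is its second fundamental form in $\mathbb S^N$. Invariant. $\Theta_{\mathbb R}(E)=0$, $\Theta_{\mathbb C}(E)=\sum_{i,j=1}^k\langle Ju_i,u_j\rangle_{\mathbb R}^2$, $\Theta_{\mathbb H}(E)=\sum_{\alpha=1}^3\sum_{i,j=1}^k\langle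 J_\alpha u_i,u_j\rangle_{\mathbb R}^2$; these do not depend on the choice of $g_0$-orthonormal basis or admissible frame. *)

(* Defs.v *)
From HB Require Import structures.
From mathcomp Require Import all_boot all_order all_algebra.
From mathcomp Require Import all_classical all_reals all_analysis.
From mathcomp Require Import complex ring.

Set Implicit Arguments.
Unset Strict Implicit.
Unset Printing Implicit Defensive.

Import Order.TTheory GRing.Theory Num.Theory.
Local Open Scope classical_set_scope.
Local Open Scope ring_scope.

(* The quaternions [a + b i + c j + d k], with Hamilton's product. *)
Record quaternion (R : Type) : Type := Quaternion
  { quat1 : R; quati : R; quatj : R; quatk : R }.

Module Quaternion.

Definition to_tuple (R : Type) (p : quaternion R) : R * R * R * R :=
  let: Quaternion a b c d := p in (a, b, c, d).
Definition of_tuple (R : Type) (t : R * R * R * R) : quaternion R :=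
  let: (a, b, c, d) := t in Quaternion a b c d.
Lemma to_tupleK (R : Type) : cancel (@to_tuple R) (@of_tuple R).
Proof. by case. Qed.

Definition opp (R : pzRingType) (p : quaternion R) : quaternion R :=
  let: Quaternion a b c d := p in Quaternion (- a) (- b) (- c) (- d).
Definition add (R : pzRingType) (p q : quaternion R) : quaternion R :=
  let: Quaternion a b c d := p in let: Quaternion a' b' c' d' := q in
  Quaternion (a + a') (b + b') (c + c') (d + d').
Definition mul (R : pzRingType) (p q : quaternion R) : quaternion R :=
  let: Quaternion a b c d := p in let: Quaternion a' b' c' d' := q in
  Quaternion (a * a' - b * b' - c * c' - d * d')
             (a * b' + b * a' + c * d' - d * c')
             (a * c' - b * d' + c * a' + d * b')
             (a * d' + b * c' - c * b' + d * a').

End Quaternion.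

HB.instance Definition _ (R : eqType) := Equality.copy (quaternion R)
  (can_type (@Quaternion.to_tupleK R)).
HB.instance Definition _ (R : choiceType) := Choice.copy (quaternion R)
  (can_type (@Quaternion.to_tupleK R)).

Section QuaternionRing.
Variable R : comNzRingType.
Local Notation H := (quaternion R).

Fact quaternion_addA : associative (@Quaternion.add R).
Proof. by move=> [a b c d] [? ? ? ?] [? ? ? ?] /=; rewrite !addrA. Qed.
Fact quaternion_addC : commutative (@Quaternion.add R).
Proof. by move=> [a b c d] [? ? ? ?] /=; congr Quaternion; exact: addrC. Qed.
Fact quaternion_add0 : left_id (Quaternion 0 0 0 0) (@Quaternion.add R).
Proof. by move=> [a b c d] /=; rewrite !add0r. Qed.
Fact quaternion_addN :
  left_inverse (Quaternion 0 0 0 0) (@Quaternion.opp R) (@Quaternion.add R).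
Proof. by move=> [a b c d] /=; rewrite !addNr. Qed.

HB.instance Definition _ := GRing.isZmodule.Build H
  quaternion_addA quaternion_addC quaternion_add0 quaternion_addN.

Fact quaternion_mulA : associative (@Quaternion.mul R).
Proof.
by move=> [a b c d] [a' b' c' d'] [? ? ? ?] /=; congr Quaternion; ring.
Qed.
Fact quaternion_mul1l : left_id (Quaternion 1 0 0 0) (@Quaternion.mul R).
Proof. by move=> [a b c d] /=; congr Quaternion; ring. Qed.
Fact quaternion_mul1r : right_id (Quaternion 1 0 0 0) (@Quaternion.mul R).
Proof. by move=> [a b c d] /=; congr Quaternion; ring. Qed.
Fact quaternion_mulDl : left_distributive (@Quaternion.mul R) +%R.
Proof.
by move=> [a b c d] [? ? ? ?] [? ? ? ?]; congr Quaternion; ring.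
Qed.
Fact quaternion_mulDr : right_distributive (@Quaternion.mul R) +%R.
Proof.
by move=> [a b c d] [? ? ? ?] [? ? ? ?]; congr Quaternion; ring.
Qed.
Fact quaternion_1neq0 : Quaternion 1 0 0 0 != 0 :> H.
Proof. by apply/eqP => -[] /eqP; rewrite oner_eq0. Qed.

HB.instance Definition _ := GRing.Zmodule_isNzRing.Build H
  quaternion_mulA quaternion_mul1l quaternion_mul1r
  quaternion_mulDl quaternion_mulDr quaternion_1neq0.

End QuaternionRing.

Inductive field_kind := Reals | Complexes | Quaternions.

Definition scalars (R : realType) (F : field_kind) : nzRingType :=
  match F with
  | Reals => R
  | Complexes => R[i]
  | Quaternions => quaternion R
  end.

Section Scalars.
Variables (R : realType) (F : field_kind).

Definition sreal : R -> scalars R F :=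
  match F return R -> scalars R F with
  | Reals => fun a => a
  | Complexes => fun a => (a +i* 0)%C
  | Quaternions => fun a => Quaternion a 0 0 0
  end.

Definition sre : scalars R F -> R :=
  match F return scalars R F -> R with
  | Reals => fun a => a
  | Complexes => fun a => complex.Re a
  | Quaternions => fun a => quat1 a
  end.

Definition sconj : scalars R F -> scalars R F :=
  match F return scalars R F -> scalars R F with
  | Reals => fun a => a
  | Complexes => fun a => conjc a
  | Quaternions => fun p =>
      let: Quaternion a b c d := p in Quaternion a (- b) (- c) (- d)
  end.

Definition imaginary_units : seq (scalars R F) :=
  match F return seq (scalars R F) with
  | Reals => [::]
  | Complexes => [:: (0 +i* 1)%C]
  | Quaternions => [:: Quaternion 0 1 0 0; Quaternion 0 0 1 0;
                       Quaternion 0 0 0 1]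
  end.

(* An orthonormal basis of the real vector space F for [Re (a^* b)], so that
   a = \sum_(e <- real_basis) Re (e^* a) e. *)
Definition real_basis : seq (scalars R F) := 1 :: imaginary_units.

End Scalars.

Arguments sreal {R F} _.
Arguments sre {R F} _.
Arguments sconj {R F} _.
Arguments imaginary_units : clear implicits.
Arguments real_basis : clear implicits.

Section Matrices.
Variables (R : realType) (F : field_kind).

Definition adjoint p q (A : 'M[scalars R F]_(p, q)) : 'M[scalars R F]_(q, p) :=
  map_mx sconj A^T.

(* The real inner product Re (x^* y) of F^n. *)
Definition rdot n (x y : 'cV[scalars R F]_n) : R :=
  sre ((adjoint x *m y) ord0 ord0).

Definition rnorm n (x : 'cV[scalars R F]_n) : R := Num.sqrt (rdot x x).

(* Componentwise derivative of a curve of matrices, in the real coordinates of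
   F given by [real_basis]. *)
Definition sderive (h : R -> scalars R F) (t : R) : scalars R F :=
  \sum_(e <- real_basis R F)
    sreal (derive1 (fun s => sre (sconj e * h s)) t) * e.

Definition mxderive p q (g : R -> 'M[scalars R F]_(p, q)) (t : R) :
    'M[scalars R F]_(p, q) :=
  \matrix_(i, j) sderive (fun s => g s i j) t.

(* Real directional derivative of [f] at [w] along [v]. *)
Definition dirderive n p q (f : 'cV[scalars R F]_n -> 'M[scalars R F]_(p, q))
    (v w : 'cV[scalars R F]_n) : 'M[scalars R F]_(p, q) :=
  mxderive (fun t => f (w + sreal t *: v)) 0.

Definition hermitian0 n : set 'M[scalars R F]_n :=
  [set A | adjoint A = A /\ \tr A = 0].

Definition hdot n (A B : 'M[scalars R F]_n) : R := sre (\tr (A *m B)).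

Definition hnorm n (A : 'M[scalars R F]_n) : R := Num.sqrt (hdot A A).

(* Orthogonal projection for [hdot] onto the real linear subspace [S]. *)
Definition hproj n (S : set 'M[scalars R F]_n) (A : 'M[scalars R F]_n) :
    'M[scalars R F]_n :=
  xget 0 [set W | S W /\ forall Z, S Z -> hdot (A - W) Z = 0].

(* [u] is an orthonormal basis of the real subspace [E] for the metric [g]. *)
Definition orthonormal_basis n (g : 'cV[scalars R F]_n -> 'cV[scalars R F]_n -> R)
    (E : set 'cV[scalars R F]_n) k (u : 'I_k -> 'cV[scalars R F]_n) : Prop :=
  (forall i j, g (u i) (u j) = (i == j)%:R) /\
  E = [set v | exists c : 'I_k -> R, v = \sum_(i < k) sreal (c i) *: u i].

End Matrices.

Arguments hermitian0 {R F} n.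

(* A point [x] of FP^m is given by a representative x in the unit sphere of
   F^(m+1), and T_[x] FP^m is identified with the horizontal space x^perp of the
   Riemannian submersion from the sphere; the metric g_0 is then the restriction
   of [rdot]. *)
Section ProjectiveSpace.
Variables (R : realType) (F : field_kind) (m : nat).
Local Notation Fn := 'cV[scalars R F]_m.+1.
Local Notation Hn := 'M[scalars R F]_m.+1.

Definition unit_sphere : set Fn := [set x | rnorm x = 1].

Definition tangent_space (x : Fn) : set Fn := [set u | adjoint x *m u = 0].

Definition g0 (u v : Fn) : R := rdot u v.

Definition metric_scale : R := 2 * m.+1%:R / m%:R.

Definition gPhi (u v : Fn) : R := metric_scale * g0 u v.

(* Only meant for a unit vector [x]. *)
Definition Phi (x : Fn) : Hn :=
  sreal (Num.sqrt (m.+1%:R / m%:R)) *: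
    (x *m adjoint x - (sreal (m.+1%:R^-1))%:M).

(* The affine chart w |-> [x + w] of FP^m around [x], for w in the tangent space
   at [x]; its differential at 0 is the identity of that space. *)
Definition chart (x w : Fn) : Fn := sreal (rnorm (x + w))^-1 *: (x + w).

Definition Phi_chart (x w : Fn) : Hn := Phi (chart x w).

Definition dPhi (x v : Fn) : Hn := dirderive (Phi_chart x) v 0.

(* The normal space at [x] of the image of Phi in the unit sphere of the space
   of trace-free Hermitian matrices. *)
Definition normal_space (x : Fn) : set Hn :=
  [set W | [/\ hermitian0 m.+1 W, hdot W (Phi x) = 0 &
             forall v, tangent_space x v -> hdot W (dPhi x v) = 0]].

(* The second fundamental form B(u, v) of Phi in the unit sphere: the normal
   component of D_u (dPhi(V)), where V extends v as a constant field in the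
   chart. The component of D_u (dPhi(V)) along Phi x is removed as well, since
   the Levi-Civita connection of the sphere is the tangential part of D. *)
Definition second_fundamental_form (x u v : Fn) : Hn :=
  hproj (normal_space x) (dirderive (dirderive (Phi_chart x) v) u 0).

(* Right multiplication by [e]: J when e = i, and J_1, J_2, J_3 when
   e = i, j, k. *)
Definition Jmul (e : scalars R F) (u : Fn) : Fn := u *m e%:M.

Definition theta_basis k (u : 'I_k -> Fn) : R :=
  \sum_(e <- imaginary_units R F) \sum_(i < k) \sum_(j < k)
    rdot (Jmul e (u i)) (u j) ^+ 2.

(* The common value of [theta_basis] on the g_0-orthonormal bases of [E]. *)
Definition Theta (E : set Fn) : R :=
  xget 0 [set t | exists k (u : 'I_k -> Fn),
                    orthonormal_basis g0 E u /\ t = theta_basis u].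

End ProjectiveSpace.

Arguments metric_scale : clear implicits.
Arguments unit_sphere {R F m}.
Arguments g0 {R F m}.
Arguments gPhi {R F m}.

(* Main.v *)
(** Along the line [w = r u] the chart expression of Phi is an affine
combination of [x x^*], [x u^* + u x^*] and [u u^*] with rational coefficients
in [r]; its second derivative at 0 is [2c (u u^* - |u|^2 x x^* )] with
[c = sqrt ((m+1)/m)]. Removing the multiple of Phi x that it contains gives
[B(u,u) = 2c (u u^* - (|u|^2/m) P)], where [P = I - x x^*] has real trace [m],
and this is normal because it annihilates x. Summing, with [Q = sum_i u_i u_i^*]
one has [Q P = Q], [Re tr Q = k] and
[Re tr (Q^2) = sum_(i,j) |u_i^* u_j|^2 = k + Theta], whence the formula. As [Q]
depends only on the span E of the [u_i], so does [Theta]. *)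

Require Import Defs.
From mathcomp Require Import all_boot all_order all_algebra.
From mathcomp Require Import all_classical all_reals all_analysis.
From HB Require Import structures.
From mathcomp Require Import complex ring.

Set Implicit Arguments.
Unset Strict Implicit.
Unset Printing Implicit Defensive.

Import Order.TTheory GRing.Theory Num.Theory numFieldNormedType.Exports.
Local Open Scope classical_set_scope.
Local Open Scope ring_scope.

(** * The scalars *)

Lemma Re_mul (R : rcfType) (p q : R[i]) :
  complex.Re (p * q) =
  complex.Re p * complex.Re q - complex.Im p * complex.Im q.
Proof. by case: p q => [? ?] [? ?]. Qed.

Lemma quat1_mul (R : comNzRingType) (p q : quaternion R) :
  quat1 (p * q) = quat1 p * quat1 q - quati p * quati q
                  - quatj p * quatj q - quatk p * quatk q.
Proof. by case: p q => [? ? ? ?] [? ? ? ?]. Qed.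

Section ScalarTheory.
Variables (R : realType) (F : field_kind).
Implicit Types (a b : R) (p q : scalars R F).

Lemma sreal_is_zmod_morphism : zmod_morphism (@sreal R F).
Proof.
case: F => a b //=; first by congr Complex; rewrite subr0.
by congr Quaternion; rewrite subr0.
Qed.

Lemma sreal_is_monoid_morphism : monoid_morphism (@sreal R F).
Proof.
case: F; split => // a b; first by congr Complex; ring.
by congr Quaternion; ring.
Qed.

HB.instance Definition _ :=
  GRing.isZmodMorphism.Build R (scalars R F) sreal sreal_is_zmod_morphism.
HB.instance Definition _ :=
  GRing.isMonoidMorphism.Build R (scalars R F) sreal sreal_is_monoid_morphism.

Lemma sre_is_zmod_morphism : zmod_morphism (@sre R F).
Proof. by case: F => [|[? ?] [? ?]|[? ? ? ?] [? ? ? ?]]. Qed.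

HB.instance Definition _ :=
  GRing.isZmodMorphism.Build (scalars R F) R sre sre_is_zmod_morphism.

Lemma sconj_is_zmod_morphism : zmod_morphism (@sconj R F).
Proof.
case: F => [|[a b] [c d]|[? ? ? ?] [? ? ? ?]] //=.
  by congr Complex; ring.
by congr Quaternion; ring.
Qed.

HB.instance Definition _ :=
  GRing.isZmodMorphism.Build (scalars R F) (scalars R F) sconj
    sconj_is_zmod_morphism.

Lemma sconjM p q : sconj (p * q) = sconj q * sconj p.
Proof.
case: F p q => [p q|[a b] [c d]|[? ? ? ?] [? ? ? ?]] /=.
- exact: mulrC.
- by congr Complex; ring.
- by congr Quaternion; ring.
Qed.

Lemma sconjK : involutive (@sconj R F).
Proof. by case: F => [|[? ?]|[? ? ? ?]] //=; rewrite !opprK. Qed.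

Lemma sconj_sreal a : sconj (sreal a) = sreal a :> scalars R F.
Proof. by case: F => //=; rewrite oppr0. Qed.

Lemma sre_sconj p : sre (sconj p) = sre p.
Proof. by case: F p => [|[? ?]|[? ? ? ?]]. Qed.

Lemma sre_sreal a : sre (sreal a : scalars R F) = a.
Proof. by case: F. Qed.

(** Real scalars are central even in the quaternions. This makes the left scaling [*:] by [sreal a]
    compatible with matrix products on both sides, although vectors form a right [F]-space. *)
Lemma sreal_comm a p : p * sreal a = sreal a * p.
Proof.
case: F p => [p|[b c]|[? ? ? ?]] /=.
- exact: mulrC.
- by congr Complex; ring.
- by congr Quaternion; ring.
Qed.

Lemma sre_sreall a p : sre (sreal a * p) = a * sre p.
Proof.
case: F p => [p|p|p] //=.
  by rewrite Re_mul /= mul0r subr0.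
by rewrite quat1_mul /= !mul0r !subr0.
Qed.

Lemma sreM p q : sre (p * q) = sre (q * p).
Proof.
case: F p q => [p q|p q|p q] /=.
- exact: mulrC.
- by rewrite !Re_mul; ring.
- by rewrite !quat1_mul; ring.
Qed.

(** Each imaginary component equals its own opposite, hence vanishes. Self-adjointness is thereby
    turned into reality of diagonal entries and traces. *)
Lemma sconj_fixed p : sconj p = p -> p = sreal (sre p).
Proof.
have fix0 (b : R) : - b = b -> b = 0.
  by move=> /eqP; rewrite eqNr => /eqP.
case: F p => [|[a b]|[a b c d]] //=.
  by case=> /fix0->.
by case=> /fix0-> /fix0-> /fix0->.
Qed.

Lemma real_basis_expansion p :
  p = \sum_(e <- real_basis R F) sreal (sre (sconj e * p)) * e.
Proof.
rewrite /real_basis; case: F p => [p|[a b]|[a b c d]] /=;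
  rewrite !big_cons big_nil.
- by rewrite /= mul1r mulr1 addr0.
- congr Complex => /=; ring.
- congr Quaternion => /=; ring.
Qed.

(** Parseval for [real_basis]. It gives positivity of the norm here, and later produces the squares
    that make up [theta_basis]. *)
Lemma sre_sconj_mul p :
  sre (sconj p * p) = \sum_(e <- real_basis R F) sre (sconj e * p) ^+ 2.
Proof.
rewrite /real_basis; case: F p => [p|[a b]|[a b c d]] /=;
  rewrite !big_cons big_nil.
- by rewrite /= mul1r addr0.
- by rewrite !Re_mul /=; ring.
- by rewrite !quat1_mul /=; ring.
Qed.

End ScalarTheory.

(** * Matrices over the scalars *)

Section MatrixTheory.
Variables (R : realType) (F : field_kind).
Implicit Types (a b : R).
Local Notation K := (scalars R F).

Lemma adjoint_is_zmod_morphism p q :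
  zmod_morphism (@adjoint R F p q).
Proof. by move=> A B; apply/matrixP => i j; rewrite !mxE raddfB. Qed.

HB.instance Definition _ p q :=
  GRing.isZmodMorphism.Build 'M[K]_(p, q) 'M[K]_(q, p) (@adjoint R F p q)
    (@adjoint_is_zmod_morphism p q).

Lemma adjointK p q (A : 'M[K]_(p, q)) : adjoint (adjoint A) = A.
Proof. by apply/matrixP => i j; rewrite !mxE sconjK. Qed.

Lemma adjointM p q r (A : 'M[K]_(p, q)) (B : 'M[K]_(q, r)) :
  adjoint (A *m B) = adjoint B *m adjoint A.
Proof.
apply/matrixP => i j; rewrite !mxE raddf_sum.
by apply: eq_bigr => l _; rewrite !mxE /= sconjM.
Qed.

Lemma adjointZ p q a (A : 'M[K]_(p, q)) :
  adjoint (sreal a *: A) = sreal a *: adjoint A.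
Proof.
by apply/matrixP => i j; rewrite !mxE sconjM sconj_sreal sreal_comm.
Qed.

Lemma adjoint_scalar n a :
  adjoint ((sreal a)%:M : 'M[K]_n) = (sreal a)%:M.
Proof.
apply/matrixP => i j; rewrite !mxE eq_sym.
by case: eqP => _; rewrite ?mulr1n ?mulr0n ?sconj_sreal ?raddf0.
Qed.

Lemma mulmxZr p q r a (A : 'M[K]_(p, q)) (B : 'M[K]_(q, r)) :
  A *m (sreal a *: B) = sreal a *: (A *m B).
Proof.
apply/matrixP => i j; rewrite !mxE mulr_sumr.
by apply: eq_bigr => l _; rewrite !mxE mulrA sreal_comm mulrA.
Qed.

(** [hdot A B] is by definition [retr (A *m B)], so every inner product below is computed through
    this additive map. *)
Definition retr n (A : 'M[K]_n) : R := sre (\tr A).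

Lemma retr_is_zmod_morphism n : zmod_morphism (@retr n).
Proof. by move=> A B; rewrite /retr !raddfB. Qed.

HB.instance Definition _ n :=
  GRing.isZmodMorphism.Build 'M[K]_n R (@retr n) (@retr_is_zmod_morphism n).

Lemma retrZ n a (A : 'M[K]_n) : retr (sreal a *: A) = a * retr A.
Proof. by rewrite /retr mxtraceZ sre_sreall. Qed.

(* Over the quaternions only the real part of the trace is cyclic. *)
Lemma retrC p q (A : 'M[K]_(p, q)) (B : 'M[K]_(q, p)) :
  retr (A *m B) = retr (B *m A).
Proof.
rewrite /retr /mxtrace !raddf_sum.
under eq_bigr do rewrite mxE raddf_sum.
under [RHS]eq_bigr do rewrite mxE raddf_sum.
by rewrite exchange_big; apply: eq_bigr => i _; apply: eq_bigr => j _;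
  exact: sreM.
Qed.

Lemma retr_adjoint n (A : 'M[K]_n) : retr (adjoint A) = retr A.
Proof.
rewrite /retr /mxtrace !raddf_sum.
by apply: eq_bigr => i _; rewrite !mxE /= sre_sconj.
Qed.

Lemma retr1 n : retr (1%:M : 'M[K]_n) = n%:R.
Proof. by rewrite /retr mxtrace1 -(rmorph_nat (@sreal R F)) sre_sreal. Qed.

Lemma rdotE n (x y : 'cV[K]_n) : rdot x y = retr (adjoint x *m y).
Proof. by rewrite /rdot /retr trace_mx11. Qed.

Lemma retr_rank1 n (x y : 'cV[K]_n) : retr (x *m adjoint y) = rdot y x.
Proof. by rewrite retrC rdotE. Qed.

Lemma rdotC n (x y : 'cV[K]_n) : rdot x y = rdot y x.
Proof. by rewrite !rdotE -retr_adjoint adjointM adjointK. Qed.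

Lemma rdotDl n (x y z : 'cV[K]_n) : rdot (x + y) z = rdot x z + rdot y z.
Proof. by rewrite !rdotE raddfD mulmxDl raddfD. Qed.

Lemma rdotZl n a (x y : 'cV[K]_n) : rdot (sreal a *: x) y = a * rdot x y.
Proof. by rewrite !rdotE adjointZ -scalemxAl retrZ. Qed.

Lemma rdotDr n (x y z : 'cV[K]_n) : rdot z (x + y) = rdot z x + rdot z y.
Proof. by rewrite !(rdotC z) rdotDl. Qed.

Lemma rdotZr n a (x y : 'cV[K]_n) : rdot x (sreal a *: y) = a * rdot x y.
Proof. by rewrite !(rdotC x) rdotZl. Qed.

(** Upgrades a real normalization such as [rdot x x = 1] to the [F]-valued identity [x^* x = 1]. *)
Lemma self_adjoint_mx11 (A : 'M[K]_1) :
  adjoint A = A -> A = (sreal (retr A))%:M.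
Proof.
move=> Asa; rewrite [LHS]mx11_scalar; congr (_%:M).
rewrite /retr trace_mx11; apply: sconj_fixed.
by rewrite -{2}Asa !mxE.
Qed.

(** The condition [\tr A = 0] in [hermitian0] is [F]-valued; for self-adjoint matrices it thus
    reduces to its real part. *)
Lemma self_adjoint_trace n (A : 'M[K]_n) :
  adjoint A = A -> \tr A = sreal (retr A).
Proof.
move=> Asa; apply: sconj_fixed; rewrite raddf_sum.
by apply: eq_bigr => i _; rewrite -{2}Asa !mxE.
Qed.

Lemma hdotC n (A B : 'M[K]_n) : hdot A B = hdot B A.
Proof. exact: retrC. Qed.

Lemma hdotBl n (A B C : 'M[K]_n) : hdot (A - B) C = hdot A C - hdot B C.
Proof. by rewrite /hdot mulmxBl !raddfB. Qed.

Lemma hdotZl n a (A B : 'M[K]_n) : hdot (sreal a *: A) B = a * hdot A B.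
Proof. by rewrite /hdot -scalemxAl; exact: retrZ. Qed.

Lemma hdotZr n a (A B : 'M[K]_n) : hdot A (sreal a *: B) = a * hdot A B.
Proof. by rewrite hdotC hdotZl hdotC. Qed.

Lemma hnormZ n a (A : 'M[K]_n) : hnorm (sreal a *: A) = `|a| * hnorm A.
Proof.
by rewrite /hnorm hdotZl hdotZr mulrA -expr2 sqrtrM ?sqr_ge0 // sqrtr_sqr.
Qed.

Lemma sre_sconj_mul_ge0 (p : K) : 0 <= sre (sconj p * p).
Proof.
by rewrite sre_sconj_mul; apply: sumr_ge0 => e _; exact: sqr_ge0.
Qed.

Lemma sre_sconj_mul_eq0 (p : K) : sre (sconj p * p) = 0 -> p = 0.
Proof.
rewrite sre_sconj_mul => /eqP.
rewrite psumr_eq0 => [|e _]; last exact: sqr_ge0.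
move=> /allP p0; rewrite [p]real_basis_expansion big_seq big1 // => e /p0.
by rewrite sqrf_eq0 => /eqP->; rewrite rmorph0 mul0r.
Qed.

Lemma rdot_self_ge0 n (x : 'cV[K]_n) : 0 <= rdot x x.
Proof.
rewrite /rdot mxE raddf_sum; apply: sumr_ge0 => i _.
by rewrite !mxE /= sre_sconj_mul_ge0.
Qed.

(** Replacing one factor by its adjoint turns the trace into a Frobenius sum of squares, so [hdot]
    is definite on self-adjoint matrices. *)
Lemma hdot_self n (A : 'M[K]_n) : adjoint A = A ->
  hdot A A = \sum_i \sum_j sre (sconj (A i j) * A i j).
Proof.
move=> Asa; rewrite /hdot -{1}Asa /mxtrace raddf_sum exchange_big.
apply: eq_bigr => i _; rewrite mxE raddf_sum.
by apply: eq_bigr => j _; rewrite !mxE.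
Qed.

Lemma hdot_self_ge0 n (A : 'M[K]_n) : adjoint A = A -> 0 <= hdot A A.
Proof.
move=> /hdot_self->; apply: sumr_ge0 => i _; apply: sumr_ge0 => j _.
exact: sre_sconj_mul_ge0.
Qed.

Lemma hdot_self_eq0 n (A : 'M[K]_n) : adjoint A = A -> hdot A A = 0 -> A = 0.
Proof.
move=> /hdot_self-> /eqP.
rewrite psumr_eq0 => [/allP A0|i _]; last first.
  by apply: sumr_ge0 => j _; exact: sre_sconj_mul_ge0.
apply/matrixP => i j; rewrite mxE; apply: sre_sconj_mul_eq0.
have := A0 i (mem_index_enum i); rewrite psumr_eq0 => [/allP Ai0|l _].
  exact/eqP/Ai0/mem_index_enum.
exact: sre_sconj_mul_ge0.
Qed.

(** Two candidates [V] and [W] differ by an element of [S]. Written as [(A - W) - (A - V)], this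
    difference is orthogonal to [S], hence to itself, and definiteness makes it zero. *)
Lemma hproj_eq n (S : set 'M[K]_n) (A W : 'M[K]_n) :
  (forall Z, S Z -> adjoint Z = Z) ->
  (forall Z T, S Z -> S T -> S (Z - T)) ->
  S W -> (forall Z, S Z -> hdot (A - W) Z = 0) -> hproj S A = W.
Proof.
move=> Ssa SB SW AW; apply: xget_unique => // V [SV AV].
have SWV := SB _ _ SV SW.
apply/eqP; rewrite -subr_eq0; apply/eqP/hdot_self_eq0; first exact: Ssa.
by rewrite -[X in hdot X _](subrKA A) -(opprB A V) addrC hdotBl AW ?AV ?subrr.
Qed.

(** Three varying real coefficients and a constant term are the shape of Phi along a line. As real
    scalars are central, each real coordinate is the same combination of [f], [g], [h]. *)
Lemma sderive_affine (f g h : R -> R) (t df dg dh : R) (p q r s : K) :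
  is_derive t 1 f df -> is_derive t 1 g dg -> is_derive t 1 h dh ->
  sderive (fun y => sreal (f y) * p + sreal (g y) * q + sreal (h y) * r + s) t
  = sreal df * p + sreal dg * q + sreal dh * r.
Proof.
move=> fd gd hd; rewrite [RHS]real_basis_expansion.
apply: eq_bigr => e _; congr (sreal _ * e).
have eZ a y : sre (sconj e * (sreal a * y)) = a * sre (sconj e * y).
  by rewrite mulrA sreal_comm -mulrA sre_sreall.
have dZ (k : R -> R) (dk c : R) : is_derive t 1 k dk ->
    is_derive t 1 (fun y => k y * c) (dk * c).
  move=> kd; rewrite (_ : (fun y => k y * c) = c \*: k).
    by apply: is_derive_eq; rewrite /GRing.scale /= mulrC.
  by apply/funext => y; rewrite mulrC.
rewrite derive1E; apply: derive_val.
rewrite (_ : (fun y => _) = (fun y => f y * sre (sconj e * p)) +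
  (fun y => g y * sre (sconj e * q)) + (fun y => h y * sre (sconj e * r)) +
  cst (sre (sconj e * s))); last first.
  by apply/funext => y; rewrite !mulrDr !raddfD /= !eZ.
apply: (is_derive_eq (is_deriveD
  (is_deriveD (is_deriveD (dZ _ _ _ fd) (dZ _ _ _ gd)) (dZ _ _ _ hd))
  (is_derive_cst (sre (sconj e * s)) t 1))).
by rewrite [LHS]addr0 !mulrDr !raddfD /= !eZ.
Qed.

Lemma mxderive_affine p q (f g h : R -> R) (t df dg dh : R)
    (A B C D : 'M[K]_(p, q)) :
  is_derive t 1 f df -> is_derive t 1 g dg -> is_derive t 1 h dh ->
  mxderive (fun y => sreal (f y) *: A + sreal (g y) *: B + sreal (h y) *: C + D)
    t = sreal df *: A + sreal dg *: B + sreal dh *: C.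
Proof.
move=> fd gd hd; apply/matrixP => i j; rewrite !mxE.
rewrite -(sderive_affine _ _ _ (D i j) fd gd hd).
by apply: (congr1 (fun k => sderive k t)); apply/funext => y; rewrite !mxE.
Qed.

End MatrixTheory.

(** * Derivatives along lines *)

Section RealDerivatives.
Variable R : realType.
Implicit Types (f g : R -> R) (p q : {poly R}).

Lemma is_derive1_quot f g (t df dg : R) : g t != 0 ->
  is_derive t 1 f df -> is_derive t 1 g dg ->
  is_derive t 1 (fun y => f y / g y) ((df * g t - f t * dg) / g t ^+ 2).
Proof.
move=> gt0 fd gd; have gVd := is_deriveV gt0 gd.
apply: (is_derive_eq (is_deriveM fd gVd)).
by rewrite /GRing.scale /= /GRing.scale /=; field.
Qed.

(** Reduces the analytic derivative of a rational function to formal derivatives of polynomials,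
    which rewriting evaluates. *)
Lemma is_derive1_poly_quot p q f (t d : R) :
  (forall y, f y = p.[y] / q.[y]) -> q.[t] != 0 ->
  (p^`().[t] * q.[t] - p.[t] * q^`().[t]) / q.[t] ^+ 2 = d ->
  is_derive t 1 f d.
Proof.
move=> /funext-> qt0 <-; exact: is_derive1_quot.
Qed.

(** [dirderive] always differentiates at parameter 0; the derivative at a point [s u] of a line is
    read off the translated curve. *)
Lemma is_derive1_translate f (s df : R) :
  is_derive s 1 f df -> is_derive (0 : R) 1 (fun t => f (s + t)) df.
Proof.
move=> fd; have sd := is_derive_shift (0 : R) (1 : R) s.
have fd' : is_derive (shift s 0) 1 f df by rewrite /= add0r.
rewrite (_ : (fun t => _) = f \o shift s).
  by apply: (is_derive_eq (is_derive1_comp fd' sd)); rewrite mulr1.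
by apply/funext => t /=; rewrite addrC.
Qed.

Lemma addr1_sqr_neq0 (a r : R) : 0 <= a -> 1 + a * r ^+ 2 != 0.
Proof.
by move=> a0; rewrite gt_eqF // ltr_pwDl // mulr_ge0 // sqr_ge0.
Qed.

(* With [a = |u|^2] and [b] constant, [b r^i / (1 + a r^2)] for i = 0, 1, 2 are
   the coefficients of Phi along the line [w = r u]; the primed lemmas are their
   second derivatives at 0. *)
Section LineDerivatives.
Variables (a b : R).
Hypothesis a_ge0 : 0 <= a.

Let q : {poly R} := 1%:P + a *: 'X^2.

Let qE y : q.[y] = 1 + a * y ^+ 2.
Proof. by rewrite /q !hornerE. Qed.

Let dqE y : q^`()%R.[y] = 2 * a * y.
Proof. by rewrite /q !poly.derivE !hornerE /=; ring. Qed.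

Let q_neq0 y : q.[y] != 0.
Proof. by rewrite qE addr1_sqr_neq0. Qed.

Let derivEs := (dqE, qE, poly.derivE, hornerD, hornerN, hornerM, hornerZ,
  hornerX, hornerXn, hornerC, hornerMn).

Lemma is_derive1_line0 (s : R) : is_derive s 1 (fun r => b / (1 + a * r ^+ 2))
  (- (b * 2 * a * s) / (1 + a * s ^+ 2) ^+ 2).
Proof.
apply: (@is_derive1_poly_quot b%:P q) => // [y|].
  by rewrite !derivEs.
by rewrite !derivEs /=; field; exact: addr1_sqr_neq0.
Qed.

Lemma is_derive1_line1 (s : R) :
  is_derive s 1 (fun r => b * r / (1 + a * r ^+ 2))
    (b * (1 - a * s ^+ 2) / (1 + a * s ^+ 2) ^+ 2).
Proof.
apply: (@is_derive1_poly_quot (b *: 'X) q) => // [y|].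
  by rewrite !derivEs.
by rewrite !derivEs /=; field; exact: addr1_sqr_neq0.
Qed.

Lemma is_derive1_line2 (s : R) :
  is_derive s 1 (fun r => b * r ^+ 2 / (1 + a * r ^+ 2))
    (b * 2 * s / (1 + a * s ^+ 2) ^+ 2).
Proof.
apply: (@is_derive1_poly_quot (b *: 'X^2) q) => // [y|].
  by rewrite !derivEs.
by rewrite !derivEs /=; field; exact: addr1_sqr_neq0.
Qed.

Let q2_at0 : (q ^+ 2).[0] = 1.
Proof. by rewrite horner_exp qE expr0n mulr0 addr0 expr1n. Qed.

Let dq2_at0 : (q ^+ 2)^`()%R.[0] = 0.
Proof. by rewrite expr2 !derivEs; ring. Qed.

(** At 0 the denominator has value 1 and derivative 0, so the quotient rule leaves only the
    derivative of the numerator. *)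
Lemma is_derive1_line2_quot (p : {poly R}) :
  is_derive (0 : R) 1 (fun s => p.[s] / (1 + a * s ^+ 2) ^+ 2) p^`()%R.[0].
Proof.
apply: (@is_derive1_poly_quot p (q ^+ 2)) => [y||].
- by rewrite horner_exp qE.
- by rewrite q2_at0 oner_neq0.
- by rewrite q2_at0 dq2_at0 mulr0 subr0 mulr1 expr1n divr1.
Qed.

Lemma is_derive1_line0' : is_derive (0 : R) 1
  (fun s => - (b * 2 * a * s) / (1 + a * s ^+ 2) ^+ 2) (- (b * 2 * a)).
Proof.
rewrite (_ : (fun s => _) = fun s =>
  (- (b * 2 * a) *: 'X).[s] / (1 + a * s ^+ 2) ^+ 2).
  by apply: (is_derive_eq (is_derive1_line2_quot _)); rewrite !derivEs mulr1.
by apply/funext => s; rewrite !derivEs !mulNr.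
Qed.

Lemma is_derive1_line1' : is_derive (0 : R) 1
  (fun s => b * (1 - a * s ^+ 2) / (1 + a * s ^+ 2) ^+ 2) 0.
Proof.
rewrite (_ : (fun s => _) = fun s =>
  (b *: (1%:P - a *: 'X^2)).[s] / (1 + a * s ^+ 2) ^+ 2).
  apply: (is_derive_eq (is_derive1_line2_quot _)).
  by rewrite !derivEs; ring.
by apply/funext => s; rewrite !derivEs.
Qed.

Lemma is_derive1_line2' : is_derive (0 : R) 1
  (fun s => b * 2 * s / (1 + a * s ^+ 2) ^+ 2) (b * 2).
Proof.
rewrite (_ : (fun s => _) = fun s =>
  (b * 2 *: 'X).[s] / (1 + a * s ^+ 2) ^+ 2).
  by apply: (is_derive_eq (is_derive1_line2_quot _)); rewrite !derivEs mulr1.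
by apply/funext => s; rewrite !derivEs.
Qed.

End LineDerivatives.

End RealDerivatives.

(** * Derivatives of the standard embedding in the affine chart *)

Section ProjectiveGeometry.
Variables (R : realType) (F : field_kind) (m : nat).
Local Notation K := (scalars R F).
Local Notation Fn := 'cV[K]_m.+1.
Implicit Types (x u v : Fn).

Local Notation c := (Num.sqrt (m.+1%:R / m%:R) : R).

Lemma unit_sphere_rdot x : unit_sphere x -> rdot x x = 1.
Proof.
rewrite /unit_sphere /= /rnorm => x1.
by rewrite -(sqr_sqrtr (rdot_self_ge0 x)) x1 expr1n.
Qed.

Lemma unit_sphere_adjoint x : unit_sphere x -> adjoint x *m x = 1%:M.
Proof.
move=> /unit_sphere_rdot x1.
rewrite [LHS]self_adjoint_mx11 -?rdotE ?x1 ?rmorph1 //.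
by rewrite adjointM adjointK.
Qed.

Lemma tangent_space_adjoint x u : tangent_space x u -> adjoint u *m x = 0.
Proof.
by move=> xu; rewrite -(adjointK x) -adjointM xu raddf0.
Qed.

(** With [y = x + r u], orthogonality gives [|y|^2 = 1 + |u|^2 r^2]. The normalization in [chart]
    enters twice, so its square root disappears and [y y^* / |y|^2] is rational in [r]. *)
Lemma Phi_chart_line x u r : unit_sphere x -> tangent_space x u ->
  Phi_chart x (sreal r *: u) =
    sreal (c / (1 + rdot u u * r ^+ 2)) *: (x *m adjoint x)
  + sreal (c * r / (1 + rdot u u * r ^+ 2)) *: (x *m adjoint u + u *m adjoint x)
  + sreal (c * r ^+ 2 / (1 + rdot u u * r ^+ 2)) *: (u *m adjoint u)
  - sreal (c / m.+1%:R) *: 1%:M.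
Proof.
move=> x1 xu; set y := x + sreal r *: u.
have yy : rdot y y = 1 + rdot u u * r ^+ 2.
  have xu0 : rdot x u = 0 by rewrite rdotE xu raddf0.
  rewrite rdotDl !rdotDr !rdotZl !rdotZr unit_sphere_rdot // (rdotC u) xu0.
  by ring.
have yy0 := rdot_self_ge0 y.
have yyE : y *m adjoint y = x *m adjoint x
    + sreal r *: (x *m adjoint u + u *m adjoint x)
    + sreal (r ^+ 2) *: (u *m adjoint u).
  rewrite /y raddfD /= adjointZ mulmxDl !mulmxDr -!scalemxAl !mulmxZr.
  by rewrite scalerA -rmorphM -expr2 scalerDr !addrA.
rewrite /Phi_chart /Phi /chart -/y adjointZ -scalemxAl mulmxZr scalerA -rmorphM.
rewrite /rnorm -invfM -expr2 sqr_sqrtr // yyE yy.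
(* The mixed term is made opaque so that distributing the scalars does not split it. *)
move: (_ + _ *m adjoint x) => Q.
rewrite scalerBr -[(sreal _^-1)%:M]scalemx1 !scalerDr !scalerA -!rmorphM /=.
by rewrite !(mulrC _^-1) !mulrA.
Qed.

(** The derivative is needed along the whole line, not only at 0, because it is differentiated once
    more. *)
Lemma dirderive_Phi_chart_line x u s : unit_sphere x -> tangent_space x u ->
  dirderive (Phi_chart x) u (sreal s *: u) =
    sreal (- (c * 2 * rdot u u * s) / (1 + rdot u u * s ^+ 2) ^+ 2)
      *: (x *m adjoint x)
  + sreal (c * (1 - rdot u u * s ^+ 2) / (1 + rdot u u * s ^+ 2) ^+ 2)
      *: (x *m adjoint u + u *m adjoint x)
  + sreal (c * 2 * s / (1 + rdot u u * s ^+ 2) ^+ 2) *: (u *m adjoint u).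
Proof.
move=> x1 xu; rewrite /dirderive.
(* The curve stays on the line: [s u + t u = (s + t) u]. *)
under [X in mxderive X]funext do
  rewrite -scalerDl -rmorphD Phi_chart_line //.
have a0 := rdot_self_ge0 u.
exact: (mxderive_affine _ _ _ _
  (is_derive1_translate (is_derive1_line0 c a0 s))
  (is_derive1_translate (is_derive1_line1 c a0 s))
  (is_derive1_translate (is_derive1_line2 c a0 s))).
Qed.

Lemma dPhi_tangent x v : unit_sphere x -> tangent_space x v ->
  dPhi x v = sreal c *: (x *m adjoint v + v *m adjoint x).
Proof.
move=> x1 xv; have := dirderive_Phi_chart_line 0 x1 xv.
rewrite rmorph0 scale0r => dE; rewrite /dPhi [LHS]dE.
rewrite expr0n /= !(mulr0, addr0) oppr0 addr0 expr1n !mul0r rmorph0 !scale0r.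
by rewrite add0r addr0 divr1 mulr1.
Qed.

(** The three coefficients of the first derivative have slopes [-2c|u|^2], [0] and [2c] at 0, so the
    mixed term [x u^* + u x^*] drops out. *)
Lemma dirderive2_Phi_chart x u : unit_sphere x -> tangent_space x u ->
  dirderive (dirderive (Phi_chart x) u) u 0 =
  sreal (2 * c) *: (u *m adjoint u - sreal (rdot u u) *: (x *m adjoint x)).
Proof.
move=> x1 xu; rewrite {1}/dirderive.
(* A zero constant term is appended to match the shape of [mxderive_affine]. *)
under [X in mxderive X]funext do
  rewrite add0r dirderive_Phi_chart_line // -[X in _ + X]addr0 addrA.
rewrite (mxderive_affine _ _ _ 0 (is_derive1_line0' (rdot u u) c)
  (is_derive1_line1' (rdot u u) c) (is_derive1_line2' (rdot u u) c)).
rewrite rmorph0 scale0r addr0 addrC scalerBr scalerA -rmorphM.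
by rewrite rmorphN scaleNr (mulrC c).
Qed.

End ProjectiveGeometry.

(** * The second fundamental form *)

Section NormalComponent.
Variables (R : realType) (F : field_kind) (m : nat).
Local Notation K := (scalars R F).
Local Notation Fn := 'cV[K]_m.+1.
Implicit Types (x u v : Fn) (W : 'M[K]_m.+1).

Local Notation c := (Num.sqrt (m.+1%:R / m%:R) : R).

(** Phi x combines [x x^*] and the identity, and tangent vectors are multiples of [x v^* + v x^*].
    Pairing [W] with these vanishes since [W x = 0], [x^* W = 0] by self-adjointness, and the trace
    is zero. *)
Lemma normal_space_annihilator x W : unit_sphere x ->
  adjoint W = W -> retr W = 0 -> W *m x = 0 -> Defs.normal_space x W.
Proof.
move=> x1 Wsa trW Wx; split.
- by split; rewrite // self_adjoint_trace // trW rmorph0.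
- rewrite /Phi hdotZr hdotC hdotBl -scalemx1 hdotZl hdotC.
  rewrite [hdot W _]/hdot mulmxA Wx mul0mx.
  by rewrite [hdot 1%:M _]/hdot mul1mx -/(retr W) trW mxtrace0 raddf0 mulr0
    subrr mulr0.
- move=> v xv; rewrite dPhi_tangent // hdotZr [hdot _ _]retrC mulmxDl raddfD /=.
  by rewrite !(retrC _ W) !mulmxA Wx mul0mx raddf0 add0r retrC mulmxA
    -{1}Wsa -adjointM Wx raddf0 mul0mx raddf0 mulr0.
Qed.

Lemma tangent_projector_self_adjoint x :
  adjoint (1%:M - x *m adjoint x) = 1%:M - x *m adjoint x.
Proof.
by rewrite raddfB /= adjointM adjointK -(rmorph1 (@sreal R F)) adjoint_scalar.
Qed.

Lemma tangent_projector_mul x : unit_sphere x ->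
  (1%:M - x *m adjoint x) *m x = 0.
Proof.
move=> x1.
by rewrite mulmxBl mul1mx -mulmxA unit_sphere_adjoint // mulmx1 subrr.
Qed.

Lemma retr_tangent_projector x : unit_sphere x ->
  retr (1%:M - x *m adjoint x) = m%:R.
Proof.
move=> x1; rewrite raddfB /= retr1 retr_rank1 unit_sphere_rdot //.
by rewrite mulrSr addrK.
Qed.

(** The right-hand side is normal, its coefficient [|u|^2/m] making it trace-free, and it differs
    from the second derivative by a multiple of Phi x. No tangential correction arises in this
    chart. *)
Lemma second_fundamental_form_diag x u : (0 < m)%N ->
  unit_sphere x -> tangent_space x u ->
  second_fundamental_form x u u =
  sreal (2 * c) *: (u *m adjoint u
    - sreal (rdot u u / m%:R) *: (1%:M - x *m adjoint x)).
Proof.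
move=> m0 x1 xu; have mN0 : m%:R != 0 :> R by rewrite pnatr_eq0 -lt0n.
apply: hproj_eq.
- by move=> Z [[]].
- move=> Z T [[Zsa trZ] Zx Zv] [[Tsa trT] Tx Tv]; split.
  + by split; rewrite raddfB /= ?Zsa ?Tsa ?trZ ?trT ?subrr.
  + by rewrite hdotBl Zx Tx subrr.
  + by move=> v xv; rewrite hdotBl Zv // Tv // subrr.
- apply: normal_space_annihilator => //.
  + rewrite adjointZ raddfB /= adjointZ tangent_projector_self_adjoint.
    by rewrite adjointM adjointK.
  + rewrite retrZ raddfB /= retrZ retr_tangent_projector // retr_rank1.
    by rewrite divfK // subrr mulr0.
  + rewrite -scalemxAl mulmxBl -mulmxA tangent_space_adjoint // mulmx0.
    by rewrite -scalemxAl tangent_projector_mul // scaler0 subr0 scaler0.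
- move=> Z [_ Zx _]; rewrite dirderive2_Phi_chart //.
  set a := rdot u u.
  (* Once [u u^*] cancels, [2c] times [-a(1 + 1/m) x x^* + (a/m) I] remains; since
     [1/m = (1 + 1/m)/(m + 1)], this is proportional to Phi x, with factor read off the coefficient
     of [x x^*]. *)
  rewrite (_ : _ - _ = sreal (- (2 * a * m.+1%:R / m%:R)) *: Phi x).
    by rewrite hdotZl hdotC Zx mulr0.
  rewrite /Phi -scalerBr opprB addrC addrA subrK scalerA -rmorphM.
  move: (x *m adjoint x) => P.
  rewrite -[(sreal _^-1)%:M]scalemx1 !scalerBr !scalerA -!rmorphM /=.
  rewrite -addrA -opprD -scalerDl -rmorphD [RHS]addrC /=.
  rewrite -![- (sreal _ *: _)]scaleNr -!rmorphN /=.
  have nN0 : 1 + m%:R != 0 :> R by rewrite -mulrS pnatr_eq0.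
  by congr (sreal _ *: _ + sreal _ *: _); field; rewrite ?nN0 mN0.
Qed.

(** The square is expanded with [P = I - x x^*]: the cross term is the real trace of [Q P = Q], and
    [P P = P] has real trace [m]. *)
Lemma hnorm_sub_projector x (Q : 'M[K]_m.+1) t : unit_sphere x ->
  adjoint Q = Q -> Q *m x = 0 ->
  hnorm (Q - sreal t *: (1%:M - x *m adjoint x)) ^+ 2
  = hdot Q Q - 2 * t * retr Q + t ^+ 2 * m%:R.
Proof.
move=> x1 Qsa Qx; have pisa := tangent_projector_self_adjoint x.
rewrite /hnorm sqr_sqrtr; last first.
  by apply: hdot_self_ge0; rewrite raddfB /= adjointZ pisa Qsa.
have Qpi : hdot Q (1%:M - x *m adjoint x) = retr Q.
  by rewrite /hdot mulmxBr mulmx1 mulmxA Qx mul0mx subr0.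
have pipi : hdot (1%:M - x *m adjoint x) (1%:M - x *m adjoint x) = m%:R.
  rewrite /hdot mulmxBr mulmx1 mulmxA tangent_projector_mul // mul0mx subr0.
  exact: retr_tangent_projector.
move: (1%:M - _) pisa Qpi pipi => pi pisa Qpi pipi.
rewrite hdotBl hdotZl ![hdot _ (Q - _)]hdotC !hdotBl !hdotZl pipi.
by rewrite [hdot pi Q]hdotC Qpi; ring.
Qed.

End NormalComponent.

(** * The operator attached to an orthonormal basis, and the invariant [Theta] *)

Section OrthonormalSystems.
Variables (R : realType) (F : field_kind) (m : nat).
Local Notation K := (scalars R F).
Local Notation Fn := 'cV[K]_m.+1.
Implicit Types (E : set Fn).

(** For an orthonormal basis over the reals this need not be a projection: over the complex numbers
    the pair [u], [u i] gives [2 u u^*]. Its norm thus detects [Theta]. *)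
Definition rank1_sum k (u : 'I_k -> Fn) : 'M[K]_m.+1 :=
  \sum_i u i *m adjoint (u i).

Lemma rank1_sum_self_adjoint k (u : 'I_k -> Fn) :
  adjoint (rank1_sum u) = rank1_sum u.
Proof.
rewrite raddf_sum; apply: eq_bigr => i _ /=.
by rewrite adjointM adjointK.
Qed.

Lemma rank1_sum_mul k (u : 'I_k -> Fn) x :
  (forall i, tangent_space x (u i)) -> rank1_sum u *m x = 0.
Proof.
move=> xu; rewrite mulmx_suml big1 // => i _.
by rewrite -mulmxA tangent_space_adjoint // mulmx0.
Qed.

Lemma rdot_sumr k (u : 'I_k -> Fn) (a : 'I_k -> R) v :
  rdot v (\sum_i sreal (a i) *: u i) = \sum_i a i * rdot v (u i).
Proof.
rewrite rdotE mulmx_sumr raddf_sum; apply: eq_bigr => i _ /=.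
by rewrite mulmxZr retrZ rdotE.
Qed.

Lemma orthonormal_basis_mem E k (u : 'I_k -> Fn) i :
  orthonormal_basis g0 E u -> E (u i).
Proof.
move=> [_ ->]; exists (fun j => (j == i)%:R).
rewrite (bigD1 i) //= eqxx rmorph1 scale1r big1 ?addr0 // => j /negPf->.
by rewrite rmorph0 scale0r.
Qed.

Lemma orthonormal_basis_expansion E k (u : 'I_k -> Fn) v :
  orthonormal_basis g0 E u -> E v ->
  v = \sum_i sreal (rdot (u i) v) *: u i.
Proof.
move=> [uu ->] [a ->]; apply: eq_bigr => i _; congr (sreal _ *: _).
rewrite rdot_sumr (bigD1 i) //= [rdot _ _]uu eqxx mulr1 big1 ?addr0 // => j ji.
by rewrite [rdot _ _]uu eq_sym (negPf ji) mulr0.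
Qed.

(** Expanding each [u i] in the basis [v], or each [v j] in the basis [u], leads to the same double
    sum of real multiples of [u_i v_j^*]. *)
Lemma rank1_sum_basis E k l (u : 'I_k -> Fn) (v : 'I_l -> Fn) :
  orthonormal_basis g0 E u -> orthonormal_basis g0 E v ->
  rank1_sum u = rank1_sum v.
Proof.
move=> uE vE; rewrite /rank1_sum.
have uexp i := orthonormal_basis_expansion vE (orthonormal_basis_mem i uE).
have vexp j := orthonormal_basis_expansion uE (orthonormal_basis_mem j vE).
transitivity (\sum_i \sum_j sreal (rdot (v j) (u i)) *: (u i *m adjoint (v j))).
  apply: eq_bigr => i _; rewrite [in X in _ *m X](uexp i) raddf_sum mulmx_sumr.
  by apply: eq_bigr => j _; rewrite /= adjointZ mulmxZr.
rewrite exchange_big; apply: eq_bigr => j _ /=.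
rewrite [in RHS](vexp j) mulmx_suml.
by apply: eq_bigr => i _; rewrite -scalemxAl rdotC -vexp.
Qed.

(** By cyclicity the left side is [|p|^2] with [p = v^* w]. Parseval splits it into squares of the
    coordinates [Re(e^* p)], which are the inner products of [v e] with [w]. *)
Lemma hdot_rank1 (v w : Fn) :
  hdot (v *m adjoint v) (w *m adjoint w) =
  \sum_(e <- real_basis R F) rdot (Jmul e v) w ^+ 2.
Proof.
have eM e : rdot (Jmul e v) w = sre (sconj e * (adjoint v *m w) ord0 ord0).
  rewrite /rdot /Jmul adjointM -mulmxA mxE big_ord1; congr (sre (_ * _)).
  by rewrite !mxE mulr1n.
under eq_bigr do rewrite eM.
rewrite -sre_sconj_mul -[hdot _ _]/(retr (_ *m _)) -mulmxA retrC mulmxA.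
rewrite -mulmxA -[adjoint w *m v]adjointK adjointM adjointK retrC.
by rewrite /retr trace_mx11 mxE big_ord1 !mxE.
Qed.

Lemma retr_rank1_sum E k (u : 'I_k -> Fn) : orthonormal_basis g0 E u ->
  retr (rank1_sum u) = k%:R.
Proof.
move=> [uu _]; rewrite /rank1_sum raddf_sum /=.
under eq_bigr do rewrite retr_rank1 [rdot _ _]uu eqxx.
by rewrite sumr_const card_ord.
Qed.

(** In the sum over [real_basis], the unit [e = 1] contributes the squared Gram matrix, that is [k];
    the imaginary units contribute [theta_basis]. *)
Lemma hdot_rank1_sum E k (u : 'I_k -> Fn) : orthonormal_basis g0 E u ->
  hdot (rank1_sum u) (rank1_sum u) = k%:R + theta_basis u.
Proof.
move=> [uu _]; have -> : hdot (rank1_sum u) (rank1_sum u) =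
    \sum_(e <- real_basis R F) \sum_i \sum_j rdot (Jmul e (u i)) (u j) ^+ 2.
  rewrite -[LHS]/(retr (_ *m _)) mulmx_suml raddf_sum exchange_big /=.
  apply: eq_bigr => i _; rewrite mulmx_sumr raddf_sum exchange_big /=.
  by apply: eq_bigr => j _; rewrite -hdot_rank1.
rewrite big_cons; congr (_ + _).
transitivity (\sum_(i < k) (1 : R)); last by rewrite sumr_const card_ord.
apply: eq_bigr => i _; rewrite (bigD1 i) //= big1 => [|j ji].
  by rewrite /Jmul mulmx1 [rdot _ _]uu eqxx expr1n addr0.
by rewrite /Jmul mulmx1 [rdot _ _]uu eq_sym (negPf ji) expr0n.
Qed.

(** Justifies the choice made in [Theta]: on every orthonormal basis [theta_basis] is the squared
    norm minus the real trace of [rank1_sum], which depends only on [E]. *)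
Lemma Theta_eq E k (u : 'I_k -> Fn) : orthonormal_basis g0 E u ->
  Theta E = hdot (rank1_sum u) (rank1_sum u) - k%:R.
Proof.
move=> uE; apply: xget_unique.
  by exists k, u; split=> //; rewrite (hdot_rank1_sum uE) addrC addKr.
move=> _ [l [v [vE ->]]].
(* The lengths [k] and [l] could differ a priori; both are the real trace of the same matrix. *)
rewrite (rank1_sum_basis uE vE) (hdot_rank1_sum vE) -(retr_rank1_sum uE).
by rewrite (rank1_sum_basis uE vE) (retr_rank1_sum vE) addrC addKr.
Qed.

End OrthonormalSystems.


(** * Passage to the metric [gPhi] and the norm of the summed second fundamental form *)

Section ScaledMetric.
Variables (R : realType) (F : field_kind) (m : nat).
Local Notation K := (scalars R F).
Local Notation Fn := 'cV[K]_m.+1.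
Local Notation s := (metric_scale R m).

Lemma metric_scale_gt0 : (0 < m)%N -> 0 < s.
Proof. by move=> m0; rewrite /metric_scale divr_gt0 ?mulr_gt0 ?ltr0n. Qed.

Lemma orthonormal_basis_gPhi (E : set Fn) k (u : 'I_k -> Fn) : (0 < m)%N ->
  orthonormal_basis g0 E u ->
  orthonormal_basis gPhi E (fun i => sreal (Num.sqrt s)^-1 *: u i).
Proof.
move=> /metric_scale_gt0 s0 [uu ->].
have r0 : Num.sqrt s != 0 by rewrite gt_eqF // sqrtr_gt0.
split=> [i j|].
  rewrite /gPhi /g0 rdotZl rdotZr [rdot _ _]uu.
  by rewrite !mulrA -{1}(sqr_sqrtr (ltW s0)); field.
apply/seteqP; split=> v [a ->].
  exists (fun i => a i * Num.sqrt s); apply: eq_bigr => i _.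
  by rewrite scalerA -rmorphM mulfK.
exists (fun i => a i / Num.sqrt s); apply: eq_bigr => i _.
by rewrite scalerA -rmorphM.
Qed.

Lemma hnorm_sum_second_fundamental_form (x : Fn) (E : set Fn) k
    (u : 'I_k -> Fn) : (0 < m)%N -> unit_sphere x -> E `<=` tangent_space x ->
  orthonormal_basis g0 E u ->
  let ubar := fun i => sreal (Num.sqrt s)^-1 *: u i in
  hnorm (\sum_(i < k) second_fundamental_form x (ubar i) (ubar i)) ^+ 2
  = (k%:R * (m%:R - k%:R) + m%:R * Theta E) / (m%:R + 1).
Proof.
move=> m0 x1 Ex uE ubar; have [uu _] := uE.
have s0 := metric_scale_gt0 m0.
have mN0 : m%:R != 0 :> R by rewrite pnatr_eq0 -lt0n.
have nN0 : m%:R + 1 != 0 :> R by rewrite natr1 pnatr_eq0.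
have xu i : tangent_space x (u i) by apply/Ex/(orthonormal_basis_mem i uE).
have ss : (Num.sqrt s)^-1 * (Num.sqrt s)^-1 = s^-1.
  by rewrite -invfM -expr2 sqr_sqrtr // ltW.
have -> : \sum_(i < k) second_fundamental_form x (ubar i) (ubar i) =
    sreal (2 * Num.sqrt (m.+1%:R / m%:R) / s) *:
      (rank1_sum u - sreal (k%:R / m%:R) *: (1%:M - x *m adjoint x)).
  (* The two factors [1/sqrt s] from each [ubar i] combine to [1/s], and [|u_i| = 1] makes the
     projector coefficient [1/m] for every [i]. *)
  transitivity (\sum_(i < k) sreal (2 * Num.sqrt (m.+1%:R / m%:R) / s) *:
      (u i *m adjoint (u i) - sreal m%:R^-1 *: (1%:M - x *m adjoint x))).
    apply: eq_bigr => i _; rewrite second_fundamental_form_diag //; last first.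
      by rewrite /tangent_space /= mulmxZr xu scaler0.
    rewrite rdotZl rdotZr [rdot _ _]uu eqxx mulr1 ss adjointZ mulmxZr.
    rewrite /ubar -[X in sreal _ *: X - _]scalemxAl scalerA -rmorphM ss.
    rewrite [in RHS]rmorphM -[in RHS]scalerA.
    congr (_ *: _); rewrite [RHS]scalerBr; congr (_ - _).
    by rewrite scalerA -rmorphM.
  rewrite -scaler_sumr sumrB; congr (_ *: (_ - _)).
  rewrite sumr_const card_ord -scaler_nat scalerA.
  by rewrite -(rmorph_nat (@sreal R F)) -rmorphM.
rewrite hnormZ exprMn real_normK ?num_real //.
rewrite hnorm_sub_projector //; last first.
- exact: rank1_sum_mul.
- exact: rank1_sum_self_adjoint.
rewrite !exprMn sqr_sqrtr ?divr_ge0 ?ler0n //.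
(* The prefactor is [4 c^2 / s^2 = m/(m + 1)], and the bracket is [k + Theta - 2k^2/m + k^2/m]. *)
rewrite (Theta_eq uE) (retr_rank1_sum uE) /metric_scale -natr1.
by field; rewrite mN0 nN0.
Qed.

End ScaledMetric.

Unset Implicit Arguments.

Theorem lemma2p2 (R : realType) (F : field_kind) (m k : nat) (hm : (1 <= m)%N)
    (x : 'cV[scalars R F]_m.+1) (hx : unit_sphere x)
    (E : set 'cV[scalars R F]_m.+1) (hE : E `<=` tangent_space x)
    (u : 'I_k -> 'cV[scalars R F]_m.+1) (hu : orthonormal_basis g0 E u) :
  let ubar := fun i : 'I_k => sreal (Num.sqrt (metric_scale R m))^-1 *: u i in
  [/\ orthonormal_basis gPhi E ubar,
      hnorm (\sum_(i < k) second_fundamental_form x (ubar i) (ubar i)) ^+ 2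
        = (k%:R * (m%:R - k%:R) + m%:R * Theta E) / (m%:R + 1) &
      F = Reals ->
      hnorm (\sum_(i < k) second_fundamental_form x (ubar i) (ubar i)) ^+ 2
        = k%:R * (m%:R - k%:R) / (m%:R + 1)].
Proof.
move=> ubar; have hB := hnorm_sum_second_fundamental_form hm hx hE hu.
split=> // [|FR]; first exact: orthonormal_basis_gPhi.
rewrite hB; subst F.
(* Over the reals [imaginary_units] is empty, so [theta_basis u] is an empty sum. *)
have -> : Theta E = 0.
  by rewrite (Theta_eq hu) (hdot_rank1_sum hu) addrC addKr /theta_basis big_nil.
by rewrite mulr0 addr0.
Qed.
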